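(* Let $q=2^e$ with $e>2$. Let $P$ and $Q$ be the two maximal parabolic subgroups of $\mathrm{Sp}_4(q)$, namely the stabilizer of a $1$-dimensional subspace and the stabilizer of a totally isotropic $2$-dimensional subspace of $\mathbb{F}_q^4$; each is isomorphic to $E_q^3\rtimes\mathrm{GL}_2(q)$ and has order $q^3(q^2+q)(q-1)^2$. Then neither $(\mathrm{Sp}_4(q),P)$ nor $(\mathrm{Sp}_4(q),Q)$ is a strong Gelfand pair.
   Context: All characters are complex. A pair $(G,H)$ with $H\le G$ finite is a strong Gelfand pair if for every irreducible character $\psi$ of $H$, the induced character $\psi\uparrow G$ satisfies $\langle \psi\uparrow G,\chi\rangle\le 1$ for every irreducible character $\chi$ of $G$. $\mathrm{Sp}_4(q)$ is the symplectic group of a nondegenerate alternating form on $\mathbb{F}_q^4$. $E_q^3$ denotes an elementary abelian group of order $q^3$. *)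

(* Defs.v *)
From HB Require Import structures.
From mathcomp Require Import all_boot all_order all_algebra all_fingroup all_solvable all_field all_character.
Set Implicit Arguments. Unset Strict Implicit. Unset Printing Implicit Defensive.
Import Order.TTheory GRing.Theory Num.Theory.
Local Open Scope ring_scope.
Local Open Scope group_scope.

Definition strong_gelfand (gT : finGroupType) (G H : {group gT}) : Prop :=
  forall (i : Iirr H) (j : Iirr G), ('['Ind[G] 'chi[H]_i, 'chi[G]_j] <= 1)%R.

Section Sympl.
Variable F : finFieldType.

Definition alt_form (J : 'M[F]_4) : Prop :=
  forall v : 'rV[F]_4, (v *m J *m v^T = 0)%R.

Definition nondeg_form (J : 'M[F]_4) : Prop := J \in unitmx.

(* Isometry group of the form: g acts on row vectors by v |-> v *m g. *)
Definition Sp_set (J : 'M[F]_4) : {set {'GL_4[F]}} :=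
  [set g : {'GL_4[F]} | (GLval g *m J *m (GLval g)^T == J)%R].

Lemma Sp_group_set J : group_set (Sp_set J).
Proof.
apply/group_setP; split.
  by rewrite inE GL_1E mul1mx trmx1 mulmx1.
move=> g h; rewrite !inE => /eqP Hg /eqP Hh.
rewrite GL_MxE trmx_mul.
have -> : GLval g *m GLval h *m J *m ((GLval h)^T *m (GLval g)^T)
  = GLval g *m (GLval h *m J *m (GLval h)^T) *m (GLval g)^T.
  by rewrite !mulmxA.
by rewrite Hh Hg.
Qed.
Canonical Sp_group J := Group (Sp_group_set J).
Definition Sp J := [group of Sp_set J].

Definition stab_set k (U : 'M[F]_(k, 4)) : {set {'GL_4[F]}} :=
  [set g : {'GL_4[F]} | (U *m GLval g == U)%MS].

Lemma stab_group_set k (U : 'M[F]_(k, 4)) : group_set (stab_set U).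
Proof.
apply/group_setP; split.
  by rewrite inE GL_1E; apply/eqmxP; rewrite mulmx1.
move=> g h; rewrite !inE => /eqmxP Hg /eqmxP Hh.
apply/eqmxP; rewrite GL_MxE mulmxA.
by apply: eqmx_trans (eqmxMr _ Hg) Hh.
Qed.
Canonical stab_group k U := Group (@stab_group_set k U).

Definition parabolic J k (U : 'M[F]_(k, 4)) := (Sp J :&: stab_group U)%G.
End Sympl.

(* Main.v *)
(** Let [B] be the stabiliser of a complete isotropic flag [<f1> < <f1, f2>] and
    [lam] the linear character [alpha (x^2 y)] of [B], where [x, y] are the
    eigenvalues on the flag and [alpha] embeds the unit group of [F] in the
    complex numbers.  Since [q - 1 > 3] is odd, [lam] is fixed by no nontrivial
    Weyl group element, so [Ind lam] is irreducible by Mackey.  Each parabolic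
    [H], taken opposite to [B], has the shape [E : L] with [E] elementary abelian
    of order [q^3]; let [T = E : C], where [C] is the cyclic split torus of order
    [q - 1] fixing a character of [E] of hyperbolic type.  A linear character
    [eta] of [T] extending that character and restricting to [alpha^-1] on [C]
    induces irreducibly to [H], while both the flag fixed by [C] and a flag on
    which [C] acts freely yield an occurrence of [Ind lam] in [Ind eta].  So the
    irreducible [Ind lam] has multiplicity at least 2 in the representation
    induced from an irreducible character of [H]. *)

Require Import Defs.
From HB Require Import structures.
From mathcomp Require Import all_boot all_order all_algebra all_fingroup all_solvable all_field all_character.
From mathcomp Require Import ring.
Set Implicit Arguments. Unset Strict Implicit. Unset Printing Implicit Defensive.
Import Order.TTheory GRing.Theory Num.Theory.
Local Open Scope ring_scope.

(** * Linear characters as multiplicative functions, and Mackey's formula *)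

Definition mult_on (gT : finGroupType) (B : {set gT}) (f : gT -> algC) :=
  f 1%g = 1 /\ {in B &, forall x y, f (x * y)%g = f x * f y}.

Section Mackey.
Variable gT : finGroupType.
Implicit Types (G H B T D : {group gT}) (f : gT -> algC).

(** The representation by [1 x 1] matrices with entry [f] affords the class function, so linear
    characters can be given by explicit formulas. *)
Lemma mult_on_lin_char B f : mult_on B f ->
  exists2 lam : 'CF(B), lam \is a linear_char & {in B, lam =1 f}.
Proof.
case=> f1 fM.
have reprf : mx_repr B (fun x => (f x)%:M : 'M[algC]_1).
  by split=> [|x y Bx By]; rewrite ?f1 // fM // scalar_mxM.
exists (cfRepr (MxRepresentation reprf)).
  by rewrite qualifE /= cfRepr_char cfRepr1 eqxx.
by move=> x Bx; rewrite cfunE Bx /= mxtrace_scalar.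
Qed.

(** Passing to [t * t] discards signs; this serves for characters with a factor [psi], whose values
    are [1] and [-1]. *)
Lemma mult_on_square D f t h : mult_on D f -> t \in D -> (t ^ h)%g \in D ->
    f (t ^ h)%g * f (t ^ h)%g != f t * f t ->
  exists r, [/\ r \in D, (r ^ h)%g \in D & f (r ^ h)%g != f r].
Proof.
move=> [_ fM] Dt Dth neq; exists (t * t)%g.
split; first exact: groupM.
  by rewrite conjMg groupM.
by rewrite conjMg (fM _ _ Dth Dth) (fM _ _ Dt Dt).
Qed.

(** Translation by [d] multiplies the sum by [f d], so the sum vanishes as soon as some value
    differs from [1]. *)
Lemma sum_mult_on D f : mult_on D f ->
  \sum_(x in D) f x = if [forall x in D, f x == 1] then #|D|%:R else 0.
Proof.
case=> f1 fM; case: ifPn => [/forall_inP Df|].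
  rewrite -sumr_const; apply: eq_bigr => x Dx; exact/eqP/Df.
case/forall_inPn=> d Dd fd1.
have: (1 - f d) * \sum_(x in D) f x = 0.
  rewrite mulrBl mul1r mulr_sumr; apply/eqP; rewrite subr_eq0; apply/eqP.
  rewrite (reindex_inj (mulgI d)) /=; apply: eq_big => x; first by rewrite groupMl.
  by rewrite groupMl // => Dx; rewrite fM.
by move/eqP; rewrite mulf_eq0 subr_eq0 eq_sym (negPf fd1) => /eqP.
Qed.

Variables (G B T : {group gT}) (lam : 'CF(B)) (eta : 'CF(T)).
Hypotheses (sBG : B \subset G) (sTG : T \subset G).
Hypotheses (lin_lam : lam \is a linear_char) (lin_eta : eta \is a linear_char).

Lemma mem_capJ g t : (t \in T :&: (B :^ g^-1)%g) = (t \in T) && (t ^ g \in B)%g.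
Proof. by rewrite inE mem_conjg invgK. Qed.

(** Mackey's condition: the conjugate of [lam] by [g] agrees with [eta] where both are defined. *)
Definition compat g := [forall t in (T :&: B :^ g^-1)%g, lam (t ^ g)%g == eta t].

(** Mackey's formula, summed over elements rather than double cosets. Frobenius reciprocity moves
    the product to [T]; for each [g] a multiplicative function is then summed over
    [T :&: B :^ g^-1], giving the order of this group or [0]. *)
Lemma cfdot_Ind_lin :
  '['Ind[G] lam, 'Ind[G] eta] =
    #|T|%:R^-1 * (#|B|%:R^-1 *
      \sum_(g in G | compat g) #|(T :&: B :^ g^-1)%g|%:R).
Proof.
rewrite -cfdot_Res_l cfdotE; congr (_ * _).
under eq_bigr => t Tt do rewrite cfResE // cfIndE // -mulrA mulr_suml.
rewrite -mulr_sumr exchange_big /= big_mkcondr /=; congr (_ * _).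
apply: eq_bigr => g Gg.
pose f t := lam (t ^ g)%g * (eta t)^-1.
have fM : mult_on (T :&: B :^ g^-1)%G f.
  rewrite /f; split; first by rewrite conj1g (lin_char1 lin_lam) (lin_char1 lin_eta) invr1 mulr1.
  move=> x y; rewrite !mem_capJ => /andP[Tx Bx] /andP[Ty By].
  by rewrite conjMg (lin_charM lin_lam) ?(lin_charM lin_eta) // invfM mulrACA.
transitivity (\sum_(t in (T :&: B :^ g^-1)%G) f t).
  (* Terms with [t ^ g] outside [B] vanish, as class functions on [B] are zero there. *)
  rewrite (bigID (fun t => t ^ g \in B)%g) /= [X in _ + X]big1 ?addr0.
    apply: eq_big => [t|t /andP[Tt _]]; first by rewrite mem_capJ.
    by rewrite /f -lin_charV_conj // lin_charV.
  by move=> t /andP[_ Bt]; rewrite cfun0 ?mul0r.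
rewrite (sum_mult_on fM) /compat; congr (if _ then _ else _).
apply: eq_forallb_in => t; rewrite inE => /andP[Tt _].
by rewrite /f -subr_eq0 -(divff (lin_char_neq0 lin_eta Tt)) -mulrBl mulf_eq0
    invr_eq0 (negPf (lin_char_neq0 lin_eta Tt)) orbF subr_eq0.
Qed.

Lemma compatM t g b : t \in T -> b \in B -> compat g -> compat (t * g * b)%g.
Proof.
move=> Tt Bb /forall_inP cg; apply/forall_inP => s.
rewrite mem_capJ => /andP[Ts Bs].
have Bs1 : ((s ^ t) ^ g \in B)%g.
  by rewrite -(groupJr _ Bb) -!conjgM ?mulgA.
by rewrite !conjgM cfunJ // -(cfunJ eta s Tt) cg // mem_capJ groupJ.
Qed.

(** The intersection has constant order along the double coset, whose size is [#|T| * #|B|] divided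
    by that order. Hence each compatible double coset counts once in [cfdot_Ind_lin]. *)
Lemma sum_card_capJ_double_coset g :
  (\sum_(h in (T :* g * B)%g) #|(T :&: B :^ h^-1)%g| = #|T| * #|B|)%N.
Proof.
transitivity (\sum_(h in (T :* g * B)%g) #|(T :&: B :^ g^-1)%g|)%N.
  apply: eq_bigr => h /mulsgP[_ b /rcosetP[t Tt ->] Bb ->].
  rewrite !invMg !conjsgM (conjGid (groupVr Bb)) -{1}(conjGid (groupVr Tt)) -conjIg.
  by rewrite cardJg.
rewrite sum_nat_const -(card_rcoset _ g^-1)%g.
have -> : ((T :* g * B) :* g^-1 = T * (B :^ g^-1))%g.
  by rewrite conjsgE invgK !mulgA.
by rewrite -mul_cardG cardJg.
Qed.

End Mackey.

(** * Irreducibility of induced characters and a multiplicity criterion *)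

Section Criterion.
Variable gT : finGroupType.
Implicit Types (G H B T : {group gT}).

(** Mackey's irreducibility criterion: only the [g] in [B] are compatible and each contributes
    [#|B|], so the norm is [1]. *)
Lemma Ind_lin_irr G B (lam : 'CF(B)) : B \subset G -> lam \is a linear_char ->
  (forall g, g \in G -> g \notin B ->
     exists b, [/\ b \in B, (b ^ g)%g \in B & lam (b ^ g)%g != lam b]) ->
  'Ind[G] lam \in irr G.
Proof.
move=> sBG lin_lam nfix; rewrite irrEchar cfInd_char ?lin_charW //=.
rewrite cfdot_Ind_lin // (eq_bigl (mem B)) => [|g].
  rewrite (eq_bigr (fun=> #|B|%:R)) => [|g Bg].
    by rewrite sumr_const -(mulr_natr #|B|%:R) mulKf ?mulVf ?neq0CG.
  by rewrite conjGid ?groupV // setIid.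
apply/andP/idP => [[Gg /forall_inP cg]|Bg].
  apply: contraT => /nfix[] // b [Bb Bbg] /negP[].
  by apply: cg; rewrite mem_capJ Bb.
split; first exact: subsetP Bg.
by apply/forall_inP => t; rewrite mem_capJ => /andP[Bt _]; rewrite cfunJ.
Qed.

(* If [Ind lam] and [Ind eta] are irreducible, every compatible double coset
   contributes [1] to the multiplicity of [Ind lam] in [Ind (Ind eta)]. *)
Lemma not_strong_gelfand G H B T lam eta x :
  B \subset G -> H \subset G -> T \subset H ->
  mult_on B lam -> mult_on T eta ->
  (forall g, g \in G -> g \notin B ->
     exists b, [/\ b \in B, (b ^ g)%g \in B & lam (b ^ g)%g != lam b]) ->
  (forall h, h \in H -> h \notin T ->
     exists t, [/\ t \in T, (t ^ h)%g \in T & eta (t ^ h)%g != eta t]) ->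
  {in T :&: B, lam =1 eta} ->
  x \in G -> x \notin (T * B)%g ->
  (forall t, t \in T -> (t ^ x)%g \in B -> lam (t ^ x)%g = eta t) ->
  ~ strong_gelfand G H.
Proof.
move=> sBG sHG sTH /mult_on_lin_char[lam' lin_lam lamE] /mult_on_lin_char[eta' lin_eta etaE].
move=> nfix_lam nfix_eta eq1 Gx nTBx eqx sg.
have sTG := subset_trans sTH sHG.
have /irrP[j Dj]: 'Ind[G] lam' \in irr G.
  apply: Ind_lin_irr => // g Gg nBg; have [b [Bb Bbg neq]] := nfix_lam g Gg nBg.
  by exists b; rewrite !lamE.
have /irrP[i Di]: 'Ind[H] eta' \in irr H.
  apply: Ind_lin_irr => // h Hh nTh; have [t [Tt Tth neq]] := nfix_eta h Hh nTh.
  by exists t; rewrite !etaE.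
(* By transitivity of induction the bound concerns the product of two characters induced to [G] from
   [B] and [T]. *)
have := sg i j; rewrite -Di -Dj cfIndInd // cfdotC_char ?cfInd_char ?lin_charW //.
rewrite cfdot_Ind_lin // => le1.
have compat1 : compat lam' eta' 1.
  apply/forall_inP => t; rewrite mem_capJ conjg1 => /andP[Tt Bt].
  by rewrite lamE // etaE // eq1 // inE Tt.
have compatx : compat lam' eta' x.
  apply/forall_inP => t; rewrite mem_capJ => /andP[Tt Btx].
  by rewrite lamE // etaE // eqx.
have compat_coset y : compat lam' eta' y -> y \in G ->
    {in (T :* y * B)%g, forall g, (g \in G) && compat lam' eta' g}.
  move=> cy Gy _ /mulsgP[_ b /rcosetP[t Tt ->] Bb ->].
  by rewrite compatM // !groupM // ?(subsetP sTG t) ?(subsetP sBG b).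
have disj : [disjoint (T :* 1 * B)%g & (T :* x * B)%g].
  rewrite rcoset1; apply/pred0P => g /=; apply/negP => /andP[/mulsgP[t b Tt Bb ->]].
  case/mulsgP=> _ b' /rcosetP[t' Tt' ->] Bb' eqg; case/negP: nTBx.
  have -> : x = ((t'^-1 * t) * (b * b'^-1))%g.
    by rewrite -!mulgA (mulgA t) eqg -!mulgA mulgV mulg1 mulKg.
  by rewrite mem_mulg ?groupM ?groupV.
(* The double cosets of [1] and [x] are disjoint and compatible, and each adds [#|T| * #|B|]; the
   strong Gelfand bound leaves room for only one. *)
have: (2 * (#|T| * #|B|) <=
    \sum_(g in G | compat lam' eta' g) #|(T :&: B :^ g^-1)%g|)%N.
  rewrite mul2n -addnn -{1}(sum_card_capJ_double_coset B T 1%g).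
  rewrite -(sum_card_capJ_double_coset B T x) -bigU //=.
  rewrite big_mkcond [leqRHS]big_mkcond; apply: leq_sum => g _ /=.
  case: ifP => // TBg; rewrite ifT //; move: TBg.
  by rewrite !inE => /orP[] /compat_coset; apply; rewrite ?group1.
move: le1; rewrite -natr_sum; set S := (\sum_(g in G | _) _)%N.
rewrite mulrA -invfM -natrM mulrC ler_pdivrMr ?mul1r ?ler_nat.
  move=> le1 /leq_trans/(_ le1).
  by rewrite leqNgt mulSn mul1n -[ltnLHS]addn0 ltn_add2l muln_gt0 !cardG_gt0.
by rewrite ltr0n muln_gt0 !cardG_gt0.
Qed.
End Criterion.

(** * Multiplicative and additive characters of a finite field *)

Lemma finField_expf_predcard (F : finFieldType) (x : F) : x != 0 -> x ^+ #|F|.-1 = 1.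
Proof.
move=> nz_x; apply: (mulIf nz_x); rewrite -exprSr mul1r prednK ?expf_card //.
by rewrite ltnW ?finNzRing_gt1.
Qed.

Lemma finField_prim_root (F : finFieldType) : exists z : F, (#|F|.-1).-primitive_root z.
Proof.
have n_gt0 : (0 < #|F|.-1)%N by rewrite -ltnS prednK ?finNzRing_gt1 // ltnW ?finNzRing_gt1.
pose rs := enum (predC1 (0 : F)).
have: has (#|F|.-1).-primitive_root rs.
  apply: has_prim_root; rewrite ?enum_uniq // -?cardE ?cardC1 //.
  by apply/allP => x; rewrite mem_enum unity_rootE => nz_x; rewrite finField_expf_predcard.
by case/hasP=> z _; exists z.
Qed.

(** A generator of the unit group is sent to a complex root of unity of the same order. The value
    [0] at [0] keeps multiplicativity and injectivity on all of [F]. *)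
Lemma finField_inj_char (F : finFieldType) :
  exists alpha : F -> algC, [/\ alpha 1 = 1, {morph alpha : x y / x * y} & injective alpha].
Proof.
have [z prim_z] := finField_prim_root F; have n_gt0 := prim_order_gt0 prim_z.
set n := #|F|.-1 in prim_z n_gt0.
have [w prim_w] := C_prim_root_exists n_gt0.
(* The discrete logarithm to the base [z], for nonzero [x]. *)
pose lg (x : F) := find (fun i => x == z ^+ i) (iota 0 n).
have lgP x : x != 0 -> z ^+ lg x = x.
  move=> /finField_expf_predcard/(prim_rootP prim_z)[i Di].
  have hasx : has (fun i => x == z ^+ i) (iota 0 n).
    by apply/hasP; exists (i : nat); rewrite ?mem_iota ?Di //=.
  have := nth_find 0%N hasx; rewrite nth_iota ?add0n; first by move/eqP.
  by rewrite -[X in (_ < X)%N](size_iota 0) -has_find.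
have w_eq i j : (w ^+ i == w ^+ j) = (z ^+ i == z ^+ j).
  by rewrite (eq_prim_root_expr prim_w) (eq_prim_root_expr prim_z).
have nz_w i : w ^+ i != 0.
  apply: expf_neq0; apply/eqP => w0; move: (prim_expr_order prim_w).
  by rewrite w0 expr0n gtn_eqF // => /eqP; rewrite eq_sym oner_eq0.
exists (fun x => if x == 0 then 0 else w ^+ lg x); split=> [|x y|x y].
- by rewrite oner_eq0; apply/eqP; rewrite -(expr0 w) w_eq lgP ?oner_eq0.
- rewrite mulf_eq0; have [-> | nz_x] := eqVneq x 0; first by rewrite /= mul0r.
  have [-> | nz_y] := eqVneq y 0; first by rewrite /= mulr0.
  by rewrite -exprD; apply/eqP; rewrite w_eq exprD !lgP ?mulf_neq0 // eqxx.
have [-> | nz_x] := eqVneq x 0; have [-> | nz_y] := eqVneq y 0 => //.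
- by move/esym/eqP; rewrite (negPf (nz_w _)).
- by move/eqP; rewrite (negPf (nz_w _)).
by move/eqP; rewrite w_eq !lgP // => /eqP.
Qed.

Lemma finField_add_char (F : finFieldType) :
  exists psi : F -> algC,
    [/\ psi 0 = 1, {morph psi : x y / x + y >-> x * y} & exists x, psi x != 1].
Proof.
pose gT : finGroupType := FinRing.Zmodule.sort F.
have abF : abelian [set: gT] by apply/centsP => x _ y _; apply: addrC.
have [i nz_i] : exists i : Iirr [set: gT], i != 0.
  apply/existsP; rewrite -negb_forall; apply/negP => /forallP all0.
  have: (1 < #|Iirr [set: gT]|)%N by rewrite card_Iirr_abelian // cardsT finNzRing_gt1.
  by case/card_gt1P => i [j [_ _]]; rewrite (eqP (all0 i)) (eqP (all0 j)) eqxx.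
have lin_i : 'chi_i \is a linear_char by exact: (char_abelianP _ abF).
exists 'chi_i; split; first exact: lin_char1.
  by move=> x y; apply: (lin_charM lin_i); rewrite inE.
apply/existsP; rewrite -negb_forall; apply: contra nz_i => /forallP chi1.
rewrite -irr_eq1; apply/eqP/cfun_inP => x _; rewrite cfun1E inE; exact/eqP.
Qed.

(** * Isometries of an alternating form in characteristic 2 *)

Section Form.
Variables (F : finFieldType) (J : 'M[F]_4).
(* Going through [FinGroup.sort] fixes the canonical group structure on matrices;
   with [{'GL_4[F]}] itself unification of products and conjugates is very slow. *)
Local Notation GL4 := (FinGroup.sort {'GL_4[F]}).
Implicit Types (u v w : 'rV[F]_4) (g h : GL4).

Definition form v w : F := (v *m J *m w^T) 0 0.
Definition act v (g : {'GL_4[F]}) : 'rV[F]_4 := v *m GLval g.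

Lemma formDl u v w : form (u + v) w = form u w + form v w.
Proof. by rewrite /form !mulmxDl mxE. Qed.
Lemma formDr u v w : form u (v + w) = form u v + form u w.
Proof. by rewrite /form linearD mulmxDr mxE. Qed.
Lemma formZl x v w : form (x *: v) w = x * form v w.
Proof. by rewrite /form -!scalemxAl mxE. Qed.
Lemma formZr x v w : form v (x *: w) = x * form v w.
Proof. by rewrite /form linearZ -scalemxAr mxE. Qed.

Lemma actD v w g : act (v + w) g = act v g + act w g. Proof. exact: mulmxDl. Qed.
Lemma actZ x v g : act (x *: v) g = x *: act v g. Proof. by rewrite /act -scalemxAl. Qed.
Lemma act1 v : act v 1%g = v. Proof. by rewrite /act GL_1E mulmx1. Qed.
Lemma actM v g h : act v (g * h)%g = act (act v g) h.
Proof. by rewrite /act GL_MxE mulmxA. Qed.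
Lemma actK g : cancel (act^~ g) (act^~ g^-1%g).
Proof. by move=> v; rewrite -actM mulgV act1. Qed.
Lemma actKV g : cancel (act^~ g^-1%g) (act^~ g).
Proof. by move=> v; rewrite -actM mulVg act1. Qed.

Lemma form_act g v w : g \in Sp J -> form (act v g) (act w g) = form v w.
Proof.
rewrite inE => /eqP gJ; rewrite /form /act trmx_mul.
have -> : v *m J *m w^T = v *m (GLval g *m J *m (GLval g)^T) *m w^T by rewrite gJ.
by rewrite !mulmxA.
Qed.

Hypotheses (altJ : alt_form J) (unitJ : J \in unitmx) (char2 : forall x : F, x + x = 0).

Lemma formxx v : form v v = 0. Proof. by rewrite /form altJ mxE. Qed.

Lemma oppF (x : F) : - x = x. Proof. by apply/eqP; rewrite eq_sym -addr_eq0 char2. Qed.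

Lemma formC v w : form v w = form w v.
Proof.
have := formxx (v + w); rewrite formDl !formDr !formxx add0r addr0 => /eqP.
by rewrite addr_eq0 oppF => /eqP.
Qed.

Lemma form_nondeg v : (forall w, form v w = 0) -> v = 0.
Proof.
move=> v0; have vJ0 : v *m J = 0.
  apply/rowP => i; have := v0 (delta_mx 0 i).
  by rewrite /form trmx_delta -colE mxE => ->; rewrite mxE.
by rewrite -[v]mulmx1 -(mulmxV unitJ) mulmxA vJ0 mul0mx.
Qed.

(** Testing on unit vectors gives [M *m J *m M^T = J], and the invertibility of [J] forces that of
    [M]. *)
Lemma isometry_Sp (M : 'M[F]_4) :
  (forall v w, form (v *m M) (w *m M) = form v w) ->
  exists2 g, g \in Sp J & forall v, act v g = v *m M.
Proof.
move=> isoM; have MJ : M *m J *m M^T = J.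
  apply/matrixP => i j; have := isoM (delta_mx 0 i) (delta_mx 0 j).
  have E (K : 'M[F]_4) : ((delta_mx 0 i : 'rV_4) *m K *m (delta_mx 0 j : 'rV_4)^T) 0 0 = K i j.
    by rewrite trmx_delta -rowE -colE !mxE.
  rewrite /form E -{1}(E (M *m J *m M^T)) => <-.
  by rewrite trmx_mul !mulmxA.
have unitM : M \in unitmx.
  by move: unitJ; rewrite -MJ !unitmx_mul => /andP[/andP[]].
by exists (Sub M unitM : {'GL_4[F]}) => [|v]; rewrite ?inE /act /= ?MJ.
Qed.

(* Covers transvections, long and short root elements and rank one split tori. *)
Lemma rank2_isometry a b A B C : A + B + form a b * A * B = 0 ->
  exists2 g, g \in Sp J &
    forall v, act v g = v + (A * form v a) *: b + (B * form v b + C * form v a) *: a.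
Proof.
move=> AB0.
pose M := 1%:M + J *m a^T *m (A *: b) + J *m b^T *m (B *: a) + J *m a^T *m (C *: a).
have ME v : v *m M = v + (A * form v a) *: b + (B * form v b + C * form v a) *: a.
  have E w z : v *m (J *m w^T *m z) = form v w *: z.
    by rewrite !mulmxA [v *m J *m w^T]mx11_scalar mul_scalar_mx.
  rewrite !mulmxDr mulmx1 !E !scalerA scalerDl -!addrA.
  by congr (_ + (_ *: _ + (_ *: _ + _ *: _))); rewrite mulrC.
have [v w|g Gg gE] := @isometry_Sp M; last by exists g => // v; rewrite gE ME.
rewrite !ME !(formDl, formDr, formZl, formZr) !formxx (formC b a).
rewrite (formC b w) (formC a w).
have two0 : 2%:R = 0 :> F by rewrite mulr2n char2.
set k := form a b in AB0 *; set x := form v a; set y := form v b.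
set x' := form w a; set y' := form w b; set c := form v w.
(* The hypothesis kills the coefficient of [x * y' + y * x']; the other excess terms occur twice. *)
transitivity (c + (A + B + k * A * B) * (x * y' + y * x') + 2%:R * (C * x * x' + k * A * C * x * x')).
  ring.
by rewrite AB0 two0 !mul0r !addr0.
Qed.

(** The element scales [u] by [s] and [v] by [s^-1] and fixes the orthogonal complement of this
    hyperbolic pair. *)
Lemma torus_exists u v s : form u v = 1 -> s != 0 ->
  exists2 g, g \in Sp J &
    forall w, act w g = w + ((s - 1) * form w v) *: u + ((s^-1 - 1) * form w u) *: v.
Proof.
move=> uv1 nz_s.
have [|g Gg gE] := @rank2_isometry v u (s - 1) (s^-1 - 1) 0.
  by rewrite formC uv1; field.
by exists g => // w; rewrite gE mul0r addr0.
Qed.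

Lemma mul_formE m n (A : 'M[F]_(m, 4)) (B : 'M[F]_(n, 4)) i j :
  (A *m J *m B^T) i j = form (row i A) (row j B).
Proof. by rewrite /form -row_mul tr_row !mxE; apply: eq_bigr => k _; rewrite !mxE. Qed.

Record symp_basis e1 e2 f1 f2 : Prop := SympBasis {
  sb_e1f1 : form e1 f1 = 1; sb_e2f2 : form e2 f2 = 1;
  sb_e1e2 : form e1 e2 = 0; sb_e1f2 : form e1 f2 = 0;
  sb_e2f1 : form e2 f1 = 0; sb_f1f2 : form f1 f2 = 0 }.

Lemma symp_basis_expand e1 e2 f1 f2 v : symp_basis e1 e2 f1 f2 ->
  v = form v f1 *: e1 + form v f2 *: e2 + form v e1 *: f1 + form v e2 *: f2.
Proof.
case=> e1f1 e2f2 e1e2 e1f2 e2f1 f1f2.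
pose M : 'M_4 := \matrix_i nth 0 [:: e1; e2; f1; f2] i.
(* The rows of [M'] are the dual basis in matching order, so the Gram matrix of [M] against [M'] is
   the identity and [M'] is invertible. *)
pose M' : 'M_4 := \matrix_i nth 0 [:: f1; f2; e1; e2] i.
have MM' : M *m J *m M'^T = 1%:M.
  apply/matrixP => i j; rewrite mul_formE !rowK !mxE.
  by case: i j => [[|[|[|[|//]]]] ?] [[|[|[|[|//]]]] ?] //=; rewrite ?formxx // formC.
have [_ unitM'T] := mulmx1_unit MM'.
apply/eqP; rewrite -subr_eq0; set r := _ - _; apply/eqP.
have r0 w : w \in [:: f1; f2; e1; e2] -> form r w = 0.
  rewrite !inE /r -scaleN1r => /or4P[] /eqP->;
  rewrite !(formDl, formZl, formxx) ?(formC f2 f1) ?(formC f1 e1) ?(formC f2 e1)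
    ?(formC f1 e2) ?(formC f2 e2) ?(formC e2 e1);
  rewrite ?e1f1 ?e2f2 ?e1e2 ?e1f2 ?e2f1 ?f1f2; ring.
have rM : r *m J *m M'^T = 0.
  apply/rowP => j; rewrite mul_formE row_id rowK r0 ?mxE //.
  by case: j => [[|[|[|[|//]]]] ?] /=; rewrite !inE eqxx ?orbT.
apply: form_nondeg => w; suff rJ0 : r *m J = 0 by rewrite /form rJ0 mul0mx mxE.
by rewrite -[r *m J]mulmx1 -(mulmxV unitM'T) mulmxA rM mul0mx.
Qed.
End Form.

(** * Completion to symplectic bases *)

Section Basis.
Variables (F : finFieldType) (J : 'M[F]_4).
Hypotheses (altJ : alt_form J) (unitJ : J \in unitmx) (char2 : forall x : F, x + x = 0).
Local Notation form := (form J).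
Local Notation formC := (formC altJ char2).
Local Notation formxx := (formxx altJ).

Lemma dual_vector v : v != 0 -> exists w, form v w = 1.
Proof.
move=> nz_v; have [w vw] : exists w, form v w != 0.
  apply/existsP; rewrite -negb_forall; apply: contra nz_v => /forallP v0.
  by apply/eqP/(form_nondeg unitJ) => w; apply/eqP.
by exists ((form v w)^-1 *: w); rewrite formZr mulVf.
Qed.

Lemma symp_basis_vector e1 : e1 != 0 -> exists e2 f1 f2, symp_basis J e1 e2 f1 f2.
Proof.
move=> nz_e1; have [f1 e1f1] := dual_vector nz_e1.
(* The left kernel of [N] is the orthogonal complement of [e1] and [f1]; it is nonzero because [N]
   has only two columns. *)
pose N : 'M_(4, 2) := J *m (col_mx e1 f1 : 'M_(1 + 1, 4))^T.
have [e2 nz_e2 e2N] : exists2 e2 : 'rV_4, e2 != 0 & e2 *m N = 0.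
  exists (nz_row (kermx N)); last by apply/sub_kermxP; exact: nz_row_sub.
  rewrite nz_row_eq0 -mxrank_eq0 mxrank_ker subn_eq0 -ltnNge.
  exact: leq_ltn_trans (rank_leq_col N) _.
have [e2e1 e2f1] : form e2 e1 = 0 /\ form e2 f1 = 0.
  have E i : form e2 (row i (col_mx e1 f1)) = 0.
    by rewrite -[e2](row_id 0) -mul_formE -mulmxA e2N mxE.
  split; first by have := E (lshift 1 0); rewrite rowKu row_id.
  by have := E (rshift 1 0); rewrite rowKd row_id.
have [w e2w] := dual_vector nz_e2.
(* The correction cancels the pairings of [w] with [e1] and [f1]. *)
exists e2, f1, (w + form w f1 *: e1 + form w e1 *: f1).
split; rewrite ?(formDr, formZr) ?formxx ?e1f1 ?e2w ?e2e1 ?e2f1 ?(formC f1 e1) ?e1f1 //.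
- by rewrite !mulr0 !addr0.
- by rewrite formC.
- by rewrite mulr0 mulr1 addr0 (formC e1) char2.
- by rewrite mulr0 mulr1 addr0 (formC f1) char2.
Qed.

Lemma symp_basis_plane (W : 'M[F]_(2, 4)) : \rank W = 2%N -> W *m J *m W^T = 0 ->
  exists f1 f2, symp_basis J (row 0 W) (row 1 W) f1 f2.
Proof.
move=> rkW W0; pose e1 := row 0 W; pose e2 := row 1 W.
have fullWJ : row_free (W *m J) by rewrite /row_free mxrankMfree ?rkW // row_free_unit.
(* The columns of a right inverse of [W *m J] are dual to the rows of [W]. *)
have [X WJX] := row_freeP fullWJ.
have dual i j : form (row i W) (row j X^T) = (i == j)%:R.
  by rewrite -mul_formE trmxK WJX mxE.
have e1e2 : form e1 e2 = 0 by rewrite -mul_formE W0 mxE.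
pose f1 := row 0 X^T; pose f2 := row 1 X^T.
(* The multiple of [e1] makes the two dual vectors orthogonal and leaves their pairings with [W]
   unchanged. *)
exists f1, (f2 + form f1 f2 *: e1).
split; rewrite ?(formDr, formZr) ?dual //= -/e1 -/e2.
- by rewrite (formC e2) e1e2 mulr0 addr0.
- by rewrite formxx mulr0 addr0.
- by rewrite (formC f1 e1) dual mulr1 char2.
Qed.
End Basis.

(** * The Borel subgroup and its linear character *)

Section Parabolics.
Variables (F : finFieldType) (J : 'M[F]_4) (alpha psi : F -> algC).
Hypotheses (altJ : alt_form J) (unitJ : J \in unitmx) (char2 : forall x : F, x + x = 0).
Hypotheses (alpha1 : alpha 1 = 1) (alphaM : {morph alpha : x y / x * y}) (alphaI : injective alpha).
Hypotheses (psi0 : psi 0 = 1) (psiD : {morph psi : x y / x + y >-> x * y}).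
Variable x0 : F.
Hypothesis psi_x0 : psi x0 != 1.
Variable s : F.
Hypotheses (nz_s : s != 0) (s2 : s ^+ 2 != 1) (s3 : s ^+ 3 != 1) (s4 : s ^+ 4 != 1).
Variables e1 e2 f1 f2 : 'rV[F]_4.
Hypothesis sb : symp_basis J e1 e2 f1 f2.
Local Notation form := (form J).
Local Notation formC := (formC altJ char2).
Local Notation formxx := (formxx altJ).
Local Notation GL4 := (FinGroup.sort {'GL_4[F]}).
Implicit Types g h t : GL4.

Let e1f1 : form e1 f1 = 1. Proof. by case: sb. Qed.
Let e2f2 : form e2 f2 = 1. Proof. by case: sb. Qed.
Let e1e2 : form e1 e2 = 0. Proof. by case: sb. Qed.
Let e1f2 : form e1 f2 = 0. Proof. by case: sb. Qed.
Let e2f1 : form e2 f1 = 0. Proof. by case: sb. Qed.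
Let f1f2 : form f1 f2 = 0. Proof. by case: sb. Qed.
Let f1e1 : form f1 e1 = 1. Proof. by rewrite formC. Qed.
Let f2e2 : form f2 e2 = 1. Proof. by rewrite formC. Qed.
Let e2e1 : form e2 e1 = 0. Proof. by rewrite formC. Qed.
Let f2e1 : form f2 e1 = 0. Proof. by rewrite formC. Qed.
Let f1e2 : form f1 e2 = 0. Proof. by rewrite formC. Qed.
Let f2f1 : form f2 f1 = 0. Proof. by rewrite formC. Qed.
Let sbE := (formDl, formDr, formZl, formZr, formxx,
  (e1f1, e2f2, e1e2, e1f2, e2f1, f1f2), (f1e1, f2e2, e2e1, f2e1, f1e2, f2f1)).
Let sum0E := (mulr0, mul0r, mulr1, mul1r, addr0, add0r, scale0r, scale1r).

(** Coefficients on the flag are read off by pairing with [e1] and [e2], which makes membership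
    boolean. *)
Definition borel_set : {set {'GL_4[F]}} :=
  [set g in Sp J | (act f1 g == form (act f1 g) e1 *: f1) &&
    (act f2 g == form (act f2 g) e1 *: f1 + form (act f2 g) e2 *: f2)].

Lemma borelP g : reflect (g \in Sp J /\ exists x c y, act f1 g = x *: f1 /\ act f2 g = c *: f1 + y *: f2)
  (g \in borel_set).
Proof.
rewrite [X in reflect _ X]in_set; apply: (iffP andP) => -[Gg].
  case/andP=> /eqP E1 /eqP E2; split=> //.
  by exists (form (act f1 g) e1), (form (act f2 g) e1), (form (act f2 g) e2).
case=> x [c [y [E1 E2]]]; split=> //; rewrite E1 E2 !sbE.
by rewrite !mulr0 !mulr1 addr0 add0r !eqxx.
Qed.

Lemma borel_group_set : group_set borel_set.
Proof.
apply/group_setP; split.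
  apply/borelP; split; first exact: group1.
  by exists 1, 0, 1; rewrite !act1 !scale1r scale0r add0r.
move=> g h /borelP[Gg [x [c [y [g1 g2]]]]] /borelP[Gh [x' [c' [y' [h1 h2]]]]].
apply/borelP; split; first exact: groupM.
exists (x * x'), (c * x' + y * c'), (y * y').
rewrite !actM g1 g2 actD !actZ h1 h2 scalerDr !scalerA; split=> //.
by rewrite scalerDl addrA.
Qed.
Canonical borel_group := Group borel_group_set.
Definition borel := [group of borel_set].

Definition borel_char g := alpha (form (act f1 g) e1 ^+ 2 * form (act f2 g) e2).

Lemma borel_charE g x c y : act f1 g = x *: f1 -> act f2 g = c *: f1 + y *: f2 ->
  borel_char g = alpha (x ^+ 2 * y).
Proof. by rewrite /borel_char => -> ->; rewrite !sbE !mulr1 mulr0 add0r. Qed.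

Lemma borel_char_mult : mult_on borel borel_char.
Proof.
split; first by rewrite /borel_char !act1 !sbE expr1n mulr1.
move=> g h /borelP[Gg [x [c [y [g1 g2]]]]] /borelP[Gh [x' [c' [y' [h1 h2]]]]].
rewrite (borel_charE g1 g2) (borel_charE h1 h2) -alphaM.
rewrite (@borel_charE _ (x * x') (c * x' + y * c') (y * y')).
- by rewrite exprMn mulrACA.
- by rewrite actM g1 actZ h1 scalerA.
by rewrite actM g2 actD !actZ h1 h2 scalerDr !scalerA addrA -scalerDl.
Qed.

Definition flag_eigen (p w : 'rV[F]_4) (t : GL4) (x y : F) :=
  act p t = x *: p /\ exists c, act w t = c *: p + y *: w.

(* In every relative position of the two flags a rank one torus fixes both and
   distinguishes their characters. *)
Lemma flags_torus (p w : 'rV[F]_4) : p != 0 -> form p w = 0 ->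
    ~ ((exists x, p = x *: f1) /\ (exists c y, w = c *: f1 + y *: f2)) ->
  exists t x y x' y', [/\ t \in Sp J, flag_eigen f1 f2 t x y, flag_eigen p w t x' y' &
    x' ^+ 2 * y' != x ^+ 2 * y].
Proof.
move=> nz_p pw neq_flag; have wp : form w p = 0 by rewrite formC.
have expand v := symp_basis_expand altJ unitJ char2 v sb.
have s1 : s != 1 by apply: contraNneq s2 => ->; rewrite expr1n.
(* If [f1] and [p] are not orthogonal, their torus has eigenvalues [s, 1] on one flag and [s^-1, 1]
   on the other; [s ^+ 4 != 1] separates. *)
have [f1p | nz_f1p] := eqVneq (form f1 p) 0; last first.
  have [|t Gt tE] := @torus_exists _ J altJ unitJ char2 f1 ((form f1 p)^-1 *: p) s _ nz_s.
    by rewrite formZr mulVf.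
  exists t, s, 1, s^-1, 1; split=> //.
  - split; first by rewrite tE !sbE ?mulVf //; apply/rowP=> i; rewrite !mxE; ring.
    exists ((s - 1) * form f2 ((form f1 p)^-1 *: p)).
    by rewrite tE !sbE; apply/rowP=> i; rewrite !mxE; ring.
  - split; first by rewrite tE !sbE (formC p f1); apply/rowP=> i; rewrite !mxE; field; rewrite nz_s.
    exists ((s^-1 - 1) * form w f1 * (form f1 p)^-1).
    by rewrite tE !sbE wp; apply/rowP=> i; rewrite !mxE; field; rewrite nz_f1p nz_s.
  rewrite !mulr1; apply: contraNneq s4 => E.
  by rewrite (exprD s 2 2) -{1}E exprVn mulVf ?expf_neq0.
have pf1 : form p f1 = 0 by rewrite formC.
(* If the lines agree but the planes differ, [f2] and [w] pair nontrivially; the eigenvalues are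
   [1, s] and [1, s^-1]. *)
have [pZ | pNZ] := eqVneq p (form p e1 *: f1).
  have nz_k : form p e1 != 0 by apply: contraNneq nz_p => k0; rewrite pZ k0 scale0r.
  have f1w : form f1 w = 0.
    by apply: (mulfI nz_k); rewrite mulr0 -formZl -pZ.
  have wf1 : form w f1 = 0 by rewrite formC.
  have nz_wf2 : form w f2 != 0.
    apply/eqP => wf2; case: neq_flag; split; first by exists (form p e1).
    exists (form w e1), (form w e2).
    by rewrite {1}(expand w) wf1 wf2 !scale0r !add0r.
  have [|t Gt tE] := @torus_exists _ J altJ unitJ char2 f2 ((form w f2)^-1 *: w) s _ nz_s.
    by rewrite formZr (formC f2) mulVf.
  exists t, 1, s, 1, s^-1; split=> //.
  - split; first by rewrite tE !sbE f1w; apply/rowP=> i; rewrite !mxE; ring.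
    exists 0; rewrite tE !sbE (formC f2 w) mulVf //.
    by apply/rowP=> i; rewrite !mxE; ring.
  - split.
      rewrite pZ tE !sbE f1w; apply/rowP=> i; rewrite !mxE; ring.
    exists 0; rewrite tE !sbE.
    by apply/rowP=> i; rewrite !mxE; field; rewrite nz_s nz_wf2.
  rewrite !expr1n !mul1r; apply: contraNneq s2 => E.
  by rewrite expr2 -{1}E mulVf.
(* If [p] lies in [<f1, f2>] off [<f1>], the torus of [p] and a multiple of [e2] has eigenvalues
   [1, s] and [s, 1]. *)
have [f2p | nz_f2p] := eqVneq (form f2 p) 0.
  have pf2 : form p f2 = 0 by rewrite formC.
  have pE : p = form p e1 *: f1 + form p e2 *: f2.
    by rewrite {1}(expand p) pf1 pf2 !scale0r !add0r.
  have nz_b : form p e2 != 0.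
    by apply: contraNneq pNZ => b0; rewrite {1}pE b0 scale0r addr0.
  have [|t Gt tE] := @torus_exists _ J altJ unitJ char2 p ((form p e2)^-1 *: e2) s _ nz_s.
    by rewrite formZr mulVf.
  exists t, 1, s, s, 1; split=> //.
  - split; first by rewrite tE !sbE f1p; apply/rowP=> i; rewrite !mxE; ring.
    exists ((s - 1) * form p e1 / form p e2).
    rewrite tE !sbE f2p [X in _ + _ *: X + _]pE.
    by apply/rowP=> i; rewrite !mxE; field; rewrite nz_b nz_s.
  - split; first by rewrite tE !sbE; apply/rowP=> i; rewrite !mxE; field; rewrite nz_b nz_s.
    exists ((s - 1) * ((form p e2)^-1 * form w e2)).
    by rewrite tE !sbE wp; apply/rowP=> i; rewrite !mxE; ring.
  rewrite expr1n mul1r mulr1; apply: contraNneq s1 => E.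
  by apply/eqP/(mulfI nz_s); rewrite mulr1 -expr2.
(* Now [p] is orthogonal to [f1] but not to [f2]; the eigenvalues are [1, s^-1] and [s, 1], whence
   the need for [s ^+ 3 != 1]. *)
have [|t Gt tE] := @torus_exists _ J altJ unitJ char2 p ((form f2 p)^-1 *: f2) s _ nz_s.
  by rewrite formZr (formC p) mulVf.
exists t, 1, s^-1, s, 1; split=> //.
- split; first by rewrite tE !sbE f1p; apply/rowP=> i; rewrite !mxE; ring.
  exists 0; rewrite tE !sbE.
  by apply/rowP=> i; rewrite !mxE; field; rewrite nz_s nz_f2p.
- split.
    by rewrite tE !sbE (formC p f2); apply/rowP=> i; rewrite !mxE; field; rewrite nz_s nz_f2p.
  exists ((s - 1) * ((form f2 p)^-1 * form w f2)).
  by rewrite tE !sbE wp; apply/rowP=> i; rewrite !mxE; ring.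
rewrite expr1n mul1r mulr1; apply: contraNneq s3 => E.
by rewrite exprS E mulfV.
Qed.

(* [f1 g^-1] and [f2 g^-1] span the flag fixed by [g * borel * g^-1]. *)
Lemma borel_char_separates g : g \in Sp J -> g \notin borel ->
  exists b, [/\ b \in borel, (b ^ g)%g \in borel & borel_char (b ^ g)%g != borel_char b].
Proof.
move=> Gg nBg; have Gg' : g^-1%g \in Sp J by rewrite groupV.
have [|||t [x [y [x' [y' [Gt [t1 [c t2]] [t1' [c' t2']] neq]]]]]] :=
  @flags_torus (act f1 g^-1) (act f2 g^-1).
- apply: contraTneq (oner_neq0 F) => p0.
  by rewrite negbK -e1f1 -(actKV g f1) p0 /act mul0mx formC /form !mul0mx mxE.
- by rewrite form_act.
- case=> -[x g1] [c [y g2]]; case/negP: nBg.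
  by rewrite -groupV; apply/borelP; split=> //; exists x, c, y.
have tg1 : act f1 (t ^ g)%g = x' *: f1 by rewrite conjgE mulgA !actM t1' actZ actKV.
have tg2 : act f2 (t ^ g)%g = c' *: f1 + y' *: f2.
  by rewrite conjgE mulgA !actM t2' actD !actZ !actKV.
exists t; rewrite (borel_charE t1 t2) (borel_charE tg1 tg2) (inj_eq alphaI); split=> //.
  by apply/borelP; split=> //; exists x, c, y.
by apply/borelP; split; [exact: groupJ | exists x', c', y'].
Qed.
(* [psi] takes the values [1] and [-1] only, as [F] has characteristic 2. *)
Let psi_sq x : psi x * psi x = 1. Proof. by rewrite -psiD char2. Qed.

(** For [y = x0 / (c + 1)], equal values at [c * y] and [y] would give
    [psi x0 = psi y * psi y = 1]. *)
Let psi_sep c : c != 1 -> exists y, psi (c * y) != psi y.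
Proof.
move=> c1; have nz : c + 1 != 0 by rewrite addr_eq0 (oppF char2).
exists (x0 / (c + 1)); apply: contra psi_x0 => /eqP E.
have -> : x0 = c * (x0 / (c + 1)) + x0 / (c + 1) by field.
by rewrite psiD E psi_sq.
Qed.

Let sqr1 x : x * x = 1 -> x = 1 :> F.
Proof.
move=> xx; apply/eqP; rewrite -subr_eq0 (oppF char2) -sqrf_eq0 sqrrD expr2 xx.
by rewrite expr1n mulr1 mulr2n char2 addr0 char2.
Qed.

Let act_eq0 v g : act v g = 0 -> v = 0.
Proof. by move=> vg; rewrite -(actK g v) vg /act mul0mx. Qed.

Let nz_e1 : e1 != 0.
Proof. by apply: contraTneq (oner_neq0 F) => e0; rewrite -e1f1 e0 /form !mul0mx mxE eqxx. Qed.

Lemma form_actV g v w : g \in Sp J -> form (act v g^-1) w = form v (act w g).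
Proof. by move=> Gg; rewrite -{2}(actKV g v) form_act. Qed.

Lemma act_conj g h v : act v (g ^ h)%g = act (act (act v h^-1) g) h.
Proof. by rewrite conjgE mulgA !actM. Qed.

Lemma rank2_conj t h a b A B C : h \in Sp J ->
    (forall v, act v t = v + (A * form v a) *: b + (B * form v b + C * form v a) *: a) ->
  forall v, act v (t ^ h)%g =
    v + (A * form v (act a h)) *: act b h
      + (B * form v (act b h) + C * form v (act a h)) *: act a h.
Proof. by move=> Gh tE v; rewrite act_conj tE !actD !actZ actKV !form_actV. Qed.

(** * The stabiliser of a totally isotropic plane *)

Section Plane.

(* The preimage [E : C] of the diagonal torus of the derived group of the Levi subgroup. *)
Definition plane_set : {set {'GL_4[F]}} := [set g in Sp J |
  (act e1 g == form (act e1 g) f1 *: e1) && (act e2 g == (form (act e1 g) f1)^-1 *: e2)].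

Lemma planeP g : reflect (g \in Sp J /\
    exists x, [/\ x != 0, act e1 g = x *: e1 & act e2 g = x^-1 *: e2])
  (g \in plane_set).
Proof.
rewrite [X in reflect _ X]in_set; apply: (iffP andP) => -[Gg].
  case/andP=> /eqP E1 /eqP E2; split=> //; exists (form (act e1 g) f1); split=> //.
  by apply: contraNneq nz_e1 => x0'; rewrite (@act_eq0 e1 g) // E1 x0' scale0r.
by case=> x [_ E1 E2]; split=> //; rewrite E1 E2 !sbE mulr1 !eqxx.
Qed.

Lemma plane_group_set : group_set plane_set.
Proof.
apply/group_setP; split.
  by apply/planeP; split; [exact: group1|exists 1; rewrite !act1 invr1 !scale1r oner_neq0].
move=> g h /planeP[Gg [x [nz_x g1 g2]]] /planeP[Gh [y [nz_y h1 h2]]].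
apply/planeP; split; first exact: groupM.
by exists (x * y); rewrite mulf_neq0 // !actM g1 g2 !actZ h1 h2 !scalerA invfM.
Qed.
Canonical plane_group := Group plane_group_set.

(** On [E], viewed as symmetric [2 x 2] matrices, this is [psi] of the off-diagonal entry; on the
    torus it is [alpha] of the inverse eigenvalue on [e1]. *)
Definition plane_char g :=
  psi (form (act e1 g) f1 * form (act f1 g) f2) * alpha (form (act e1 g) f1)^-1.

Lemma plane_charE g x : act e1 g = x *: e1 ->
  plane_char g = psi (x * form (act f1 g) f2) * alpha x^-1.
Proof. by rewrite /plane_char => ->; rewrite !sbE mulr1. Qed.

Lemma plane_f1 g x : g \in Sp J -> x != 0 -> act e1 g = x *: e1 -> act e2 g = x^-1 *: e2 ->
  form (act f1 g) e1 = x^-1 /\ form (act f1 g) e2 = 0.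
Proof.
move=> Gg nz_x g1 g2; split.
  by apply: (mulfI nz_x); rewrite -formZr -g1 form_act // f1e1 mulfV.
have nz_x' : x^-1 != 0 by rewrite invr_eq0.
by apply: (mulfI nz_x'); rewrite -formZr -g2 form_act // f1e2 mulr0.
Qed.

Lemma plane_char_mult : mult_on plane_set plane_char.
Proof.
split; first by rewrite /plane_char !act1 !sbE !sum0E invr1 psi0 alpha1 mulr1.
move=> g h /planeP[Gg [x [nz_x g1 g2]]] /planeP[Gh [y [nz_y h1 h2]]].
rewrite (plane_charE g1) (plane_charE h1) (@plane_charE _ (x * y)); last first.
  by rewrite actM g1 actZ h1 scalerA.
rewrite mulrACA -alphaM -psiD invfM; congr (psi _ * _).
have [E1 E2] := plane_f1 Gg nz_x g1 g2.
rewrite actM {1}(symp_basis_expand altJ unitJ char2 (act f1 g) sb) E1 E2 !actD !actZ h1 h2.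
by rewrite !sbE; field; rewrite nz_x nz_y.
Qed.

Let unipotent_char t : t \in Sp J -> act e1 t = e1 -> act e2 t = e2 ->
  t \in plane_set /\ plane_char t = psi (form (act f1 t) f2).
Proof.
move=> Gt t1 t2; split.
  by apply/planeP; split=> //; exists 1; rewrite oner_neq0 invr1 !scale1r.
by rewrite (@plane_charE _ 1) ?scale1r // invr1 alpha1 mulr1 mul1r.
Qed.

Let torus : exists t, [/\ t \in Sp J, act e1 t = s *: e1 & act e2 t = s^-1 *: e2].
Proof.
have [g Gg gE] := torus_exists altJ unitJ char2 e1f1 nz_s.
have nz_s' : s^-1 != 0 by rewrite invr_eq0.
have [h Gh hE] := torus_exists altJ unitJ char2 e2f2 nz_s'.
exists (g * h)%g; split; first exact: groupM.
  by rewrite actM gE !sbE hE !sbE; apply/rowP=> i; rewrite !mxE; ring.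
by rewrite actM gE !sbE hE !sbE; apply/rowP=> i; rewrite !mxE; ring.
Qed.

(** Elements of [E] separate unless [a * b = c * d = 0] and [a * d + b * c = 1]. Diagonal solutions
    lie in [plane_set]; for antidiagonal ones a torus element separates. *)
Lemma plane_char_separates h a b c d :
    h \in Sp J -> act e1 h = a *: e1 + b *: e2 -> act e2 h = c *: e1 + d *: e2 ->
    h \notin plane_set ->
  exists t, [/\ t \in plane_set, (t ^ h)%g \in plane_set &
    plane_char (t ^ h)%g != plane_char t].
Proof.
move=> Gh h1 h2 nTh.
pose Goal := exists t, [/\ t \in plane_set, (t ^ h)%g \in plane_set &
  plane_char (t ^ h)%g != plane_char t].
have e1in : e1 \in [:: e1; e2] by rewrite inE eqxx.
have e2in : e2 \in [:: e1; e2] by rewrite !inE eqxx orbT.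
(* The element of [E] built from [u] and [v] is conjugated to the one built from their images; [q]
   is the off-diagonal entry. *)
have sep u v A B C : u \in [:: e1; e2] -> v \in [:: e1; e2] -> A + B = 0 ->
    let q u' v' := (A * form f1 u') * form v' f2 +
      (B * form f1 v' + C * form f1 u') * form u' f2 in
    psi (q (act u h) (act v h)) != psi (q u v) -> Goal.
  move=> uE vE AB0 q neq.
  have W0 w w' : w \in [:: e1; e2] -> w' \in [:: e1; e2] ->
      form w w' = 0 /\ form w (act w' h) = 0.
    by rewrite !inE => /orP[] /eqP-> /orP[] /eqP->; rewrite ?h1 ?h2 !sbE !sum0E.
  have [|t Gt tE] := @rank2_isometry _ J altJ unitJ char2 u v A B C.
    by rewrite (proj1 (W0 u v uE vE)) !mul0r addr0.
  have thE := rank2_conj Gh tE.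
  have fix_t w : w \in [:: e1; e2] -> act w t = w /\ act w (t ^ h)%g = w.
    move=> wE; have [[wu wuh] [wv wvh]] := (W0 w u wE uE, W0 w v wE vE).
    by rewrite tE thE wu wuh wv wvh !sum0E.
  have [e1t e1th] := fix_t e1 e1in.
  have [e2t e2th] := fix_t e2 e2in.
  have [Tt eta_t] := unipotent_char Gt e1t e2t.
  have [|Tth eta_th] := @unipotent_char (t ^ h)%g _ e1th e2th.
    by exact: groupJ.
  exists t; split=> //; rewrite eta_t eta_th tE thE.
  by rewrite !(formDl, formZl) f1f2 !add0r.
(* The transvection along [e1] has off-diagonal entry [0], while its conjugate has [x0] by the
   choice of parameter. *)
have [ab0 | nz_ab] := eqVneq (a * b) 0; last first.
  apply: (sep e1 e1 0 0 (x0 / (a * b))); rewrite ?addr0 //.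
  by rewrite h1 !sbE !sum0E psi0 -mulrA divfK.
have [cd0 | nz_cd] := eqVneq (c * d) 0; last first.
  apply: (sep e2 e2 0 0 (x0 / (c * d))); rewrite ?addr0 //.
  by rewrite h2 !sbE !sum0E psi0 -mulrA divfK.
have [D1 | D_neq1] := eqVneq (a * d + b * c) 1; last first.
  have [y neq] := psi_sep D_neq1.
  apply: (sep e1 e2 y y 0); rewrite ?char2 //.
  rewrite h1 h2 !sbE !sum0E.
  by have -> : y * a * d + y * c * b = (a * d + b * c) * y by ring.
have [a0 | nz_a] := eqVneq a 0; last first.
  have b0 : b = 0 by apply: (mulfI nz_a); rewrite ab0 mulr0.
  have da : d = a^-1 by apply: (mulfI nz_a); rewrite mulfV // -[RHS]D1 b0 mul0r addr0.
  have c0 : c = 0.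
    by apply: (mulIf (x := d)); rewrite ?mul0r // da invr_eq0.
  case/negP: nTh; apply/planeP; split=> //; exists a.
  by rewrite h1 h2 b0 c0 da !sum0E.
have bc1 : b * c = 1 by rewrite -[RHS]D1 a0 mul0r add0r.
have nz_c : c != 0 by apply: contraTneq (oner_neq0 F) => c0; rewrite -bc1 c0 mulr0 eqxx.
have nz_b : b != 0 by apply: contraTneq (oner_neq0 F) => b0; rewrite -bc1 b0 mul0r eqxx.
have d0 : d = 0 by apply: (mulfI nz_c); rewrite cd0 mulr0.
have [t [Gt t1 t2]] := torus.
have Tt : t \in plane_set by apply/planeP; split=> //; exists s.
have h1' : act e1 h^-1 = c^-1 *: e2.
  by rewrite -[RHS](actK h) actZ h2 d0 scale0r addr0 scalerA mulVf ?scale1r.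
have h2' : act e2 h^-1 = b^-1 *: e1.
  by rewrite -[RHS](actK h) actZ h1 a0 scale0r add0r scalerA mulVf ?scale1r.
have th1 : act e1 (t ^ h)%g = s^-1 *: e1.
  rewrite act_conj h1' !actZ t2 !actZ h2 d0 scale0r addr0 !scalerA; congr (_ *: _).
  by field; rewrite ?nz_c ?nz_s.
have th2 : act e2 (t ^ h)%g = s *: e2.
  rewrite act_conj h2' !actZ t1 !actZ h1 a0 scale0r add0r !scalerA; congr (_ *: _).
  by field; rewrite ?nz_b ?nz_s.
have Gth : (t ^ h)%g \in Sp J := groupJ Gt Gh.
have Tth : (t ^ h)%g \in plane_set.
  apply/planeP; split; first exact: Gth.
  by exists s^-1; rewrite invr_eq0 invrK.
(* Conjugation by [h] inverts the eigenvalue of [t]. Squaring removes [psi], and [s ^+ 4 != 1]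
   separates the remaining values of [alpha]. *)
apply: (@mult_on_square _ plane_group _ _ _ plane_char_mult Tt Tth).
rewrite (plane_charE t1) (plane_charE th1).
rewrite mulrACA psi_sq [X in _ != X]mulrACA psi_sq !mul1r -!alphaM (inj_eq alphaI).
rewrite invrK; apply: contraNneq s4 => E; rewrite (exprD s 2 2) !expr2 {1}E.
by rewrite mulrACA mulVf ?mulr1.
Qed.

Lemma not_strong_gelfand_plane (H : {group {'GL_4[F]}}) : H \subset Sp J ->
    plane_set \subset H ->
    (forall h, h \in H -> exists a b c d,
      act e1 h = a *: e1 + b *: e2 /\ act e2 h = c *: e1 + d *: e2) ->
  ~ strong_gelfand (Sp J) H.
Proof.
move=> sHG sTH Hact.
(* The second flag, the image of the first under [z'], is [<f1 + f2> < <f1, f2>]. *)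
have [|z' Gz' z'E] := @rank2_isometry _ J altJ unitJ char2 e1 f2 1 1 0.
  by rewrite e1f2 !mul0r addr0 char2.
have z'1 : act f1 z' = f1 + f2 by rewrite z'E !sbE !sum0E.
have z'2 : act f2 z' = f2 by rewrite z'E !sbE !sum0E.
apply: (@not_strong_gelfand _ (Sp J) H borel plane_group _ plane_char z'^-1%g
  _ sHG sTH borel_char_mult plane_char_mult _ _ _ _ _ _).
- by apply/subsetP=> g; rewrite inE => /andP[].
- by move=> g Gg Bg; exact: borel_char_separates Gg Bg.
- move=> h Hh; have [a [b [c [d [h1 h2]]]]] := Hact h Hh.
  exact: (plane_char_separates (subsetP sHG _ Hh) h1 h2).
(* The eigenvalues on [f1] and [f2] are [x^-1] and [x], so both characters give [alpha x^-1]. *)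
- move=> g /setIP[/planeP[Gg [x [nz_x g1 g2]]] /borelP[_ [y [c [z [g3 g4]]]]]].
  have [E1 _] := plane_f1 Gg nz_x g1 g2.
  rewrite (borel_charE g3 g4) (plane_charE g1) g3 !sbE !sum0E psi0 mul1r.
  move: E1; rewrite g3 !sbE mulr1 => ->.
  have -> : z = x.
    apply: (mulfI (x := x^-1)); rewrite ?invr_eq0 // mulVf //.
    by rewrite mulrC; have := form_act e2 f2 Gg; rewrite g2 g4 !sbE !sum0E => ->.
  by rewrite expr2 mulfVK.
- by rewrite groupV.
(* Otherwise [b * z'] lies in [T]; but it sends [f1] to a multiple of [f1 + f2], whereas [T] creates
   no [f2]-component. *)
- apply/negP => /mulsgP[t b Tt /borelP[Gb [x [c [y [b1 _]]]]] Db].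
  have Tt' : (t^-1)%g \in plane_group by rewrite groupV.
  have Dt' : (t^-1 = b * z')%g by rewrite -[b](mulKg t) -Db mulgKV.
  case/planeP: Tt' => Gt' [r [nz_r r1 r2]].
  have [E1 E2] := plane_f1 Gt' nz_r r1 r2.
  move: E1 E2; rewrite Dt' actM b1 actZ z'1 !sbE !sum0E => -> /eqP.
  by rewrite invr_eq0 (negPf nz_r).
move=> t Tt; rewrite conjgE invgK => /borelP[_ [x [c [y [b1 b2]]]]].
case/planeP: (Tt) => Gt [r [nz_r r1 r2]].
have [E11 E12] := plane_f1 Gt nz_r r1 r2.
have [E21 E22] : form (act f2 t) e1 = 0 /\ form (act f2 t) e2 = r.
  split; last first.
    have := form_act f2 e2 Gt; rewrite r2 formZr f2e2 => /(canRL (mulKf _)).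
    by rewrite invr_eq0 invrK mulr1; apply.
  by apply: (mulfI nz_r); rewrite -formZr -r1 form_act // f2e1 mulr0.
have b1' : act f1 t + act f2 t = x *: (f1 + f2).
  by rewrite -actD -z'1 -actZ -b1 !actM actKV.
have b2' : act f2 t = c *: (f1 + f2) + y *: f2.
  by rewrite -z'1 -{2}z'2 -!actZ -actD -b2 !actM actKV -{1}z'2.
have c0 : c = 0 by move: E21; rewrite b2' !sbE !sum0E.
have yr : y = r by move: E22; rewrite b2' c0 !sbE !sum0E.
have xr' : x = r^-1.
  by move: (congr1 (form^~ e1) b1'); rewrite /= formDl E11 E21 !sbE !sum0E.
have xr : x = r.
  by move: (congr1 (form^~ e2) b1'); rewrite /= formDl E12 E22 !sbE !sum0E.
have x1 : x = 1 by apply: sqr1; rewrite {1}xr' xr mulVf.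
have f1t : form (act f1 t) f2 = 0.
  by move: (congr1 (form^~ f2) b1'); rewrite /= formDl [act f2 t]b2' !sbE !sum0E.
rewrite (borel_charE b1 b2) (plane_charE r1) f1t yr -xr x1.
by rewrite invr1 expr1n !sum0E psi0 mul1r.
Qed.
End Plane.

(** * The stabiliser of a point *)

Section Point.

(* Quadratic: the short root part of [E] contributes a hyperbolic form. *)
Let quad (v : 'rV[F]_4) := form v f1 + form v f2 * form v e2.

(** This is [E : C]: on the orthogonal complement of [e1] modulo [<e1>] the action is by the split
    torus with eigenvectors [e2] and [f2]. *)
Definition point_set : {set {'GL_4[F]}} := [set g in Sp J | [&& act e1 g == e1,
  act e2 g == form (act e2 g) f2 *: e2 + form (act e2 g) f1 *: e1 &
  act f2 g == (form (act e2 g) f2)^-1 *: f2 + form (act f2 g) f1 *: e1]].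

Lemma pointP g : reflect (g \in Sp J /\ exists x k l, [/\ x != 0, act e1 g = e1,
    act e2 g = x *: e2 + k *: e1 & act f2 g = x^-1 *: f2 + l *: e1])
  (g \in point_set).
Proof.
rewrite [X in reflect _ X]in_set; apply: (iffP andP) => -[Gg].
  case/and3P=> /eqP E0 /eqP E1 /eqP E2; split=> //.
  exists (form (act e2 g) f2), (form (act e2 g) f1), (form (act f2 g) f1); split=> //.
  apply: contraTneq (oner_neq0 F) => z0; rewrite negbK -e2f2 -(form_act e2 f2 Gg) E1 E2 z0.
  by rewrite invr0 !sbE !sum0E.
case=> x [k [l [_ E0 E1 E2]]]; split=> //; apply/and3P.
by rewrite E0 E1 E2 !sbE !sum0E !eqxx.
Qed.

Lemma point_group_set : group_set point_set.
Proof.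
apply/group_setP; split.
  apply/pointP; split; first exact: group1.
  by exists 1, 0, 0; rewrite !act1 invr1 !scale1r scale0r !addr0 oner_neq0.
move=> g h /pointP[Gg [x [k [l [nz_x g0 g1 g2]]]]] /pointP[Gh [x' [k' [l' [nz_x' h0 h1 h2]]]]].
apply/pointP; split; first exact: groupM.
exists (x * x'), (x * k' + k), (x^-1 * l' + l); rewrite mulf_neq0 // !actM g0 g1 g2.
rewrite !actD !actZ h0 h1 h2 !scalerDr !scalerA invfM.
by split=> //; rewrite -addrA -scalerDl.
Qed.
Canonical point_group := Group point_group_set.

Definition point_char g := psi (quad (act f1 g)) * alpha (form (act e2 g) f2)^-1.

Lemma point_charE g x k : act e2 g = x *: e2 + k *: e1 ->
  point_char g = psi (quad (act f1 g)) * alpha x^-1.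
Proof. by rewrite /point_char => ->; rewrite !sbE !sum0E. Qed.

Lemma point_f1 g x k l : g \in Sp J -> x != 0 -> act e1 g = e1 ->
    act e2 g = x *: e2 + k *: e1 -> act f2 g = x^-1 *: f2 + l *: e1 ->
  [/\ form (act f1 g) e1 = 1, k = x * form (act f1 g) e2 & l = x^-1 * form (act f1 g) f2].
Proof.
move=> Gg nz_x g0 g1 g2.
have E : form (act f1 g) e1 = 1 by rewrite -g0 form_act.
have eq_of_sum0 (a b : F) : a + b = 0 -> b = a.
  by move/eqP; rewrite addr_eq0 (oppF char2) => /eqP.
split=> //; apply: eq_of_sum0.
  by have := form_act f1 e2 Gg; rewrite g1 formDr !formZr E f1e2 mulr1.
by have := form_act f1 f2 Gg; rewrite g2 formDr !formZr E f1f2 mulr1.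
Qed.

Lemma point_char_mult : mult_on point_set point_char.
Proof.
split; first by rewrite /point_char /quad !act1 !sbE !sum0E invr1 psi0 alpha1 mulr1.
move=> g h /pointP[Gg [x [k [l [nz_x g0 g1 g2]]]]] /pointP[Gh [x' [k' [l' [nz_x' h0 h1 h2]]]]].
rewrite (point_charE g1) (point_charE h1) (@point_charE _ (x * x') (x * k' + k)); last first.
  by rewrite actM g1 actD !actZ h0 h1 scalerDr !scalerA -addrA -scalerDl.
rewrite mulrACA -alphaM -psiD invfM; congr (psi _ * _).
have [E _ _] := point_f1 Gg nz_x g0 g1 g2.
have [E' kE lE] := point_f1 Gh nz_x' h0 h1 h2.
rewrite /quad actM {1 2 3}(symp_basis_expand altJ unitJ char2 (act f1 g) sb) E !actD !actZ h0 h1 h2 kE lE.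
rewrite !sbE !sum0E.
set z := form (act f1 g) f1; set v1 := form (act f1 g) f2; set v2 := form (act f1 g) e2.
set z' := form (act f1 h) f1; set v1' := form (act f1 h) f2; set v2' := form (act f1 h) e2.
have two0 : 2%:R = 0 :> F by rewrite mulr2n char2.
(* The cross terms of the product in [quad] equal those that composition adds to the
   [e1]-coordinate, so they cancel. *)
transitivity (z + v1 * v2 + (z' + v1' * v2') + 2%:R * (v1 * x' * v2' + v2 * x'^-1 * v1')).
  by field; rewrite nz_x'.
by rewrite two0 mul0r addr0.
Qed.

Let unipotent_char t k l : t \in Sp J -> act e1 t = e1 -> act e2 t = e2 + k *: e1 ->
  act f2 t = f2 + l *: e1 -> t \in point_set /\ point_char t = psi (quad (act f1 t)).
Proof.
move=> Gt t0 t1 t2; split.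
  by apply/pointP; split=> //; exists 1, k, l; rewrite oner_neq0 invr1 !scale1r.
by rewrite (@point_charE _ 1 k) ?scale1r // invr1 alpha1 mulr1.
Qed.

Let torus : exists t, [/\ t \in Sp J, act e1 t = e1, act e2 t = s *: e2 & act f2 t = s^-1 *: f2].
Proof.
have [t Gt tE] := torus_exists altJ unitJ char2 e2f2 nz_s.
exists t; split=> //; rewrite tE !sbE !sum0E //.
  by apply/rowP=> i; rewrite !mxE; ring.
by apply/rowP=> i; rewrite !mxE; ring.
Qed.

(** Squaring is injective in characteristic 2, hence onto a finite field. *)
Let sqrt_ex (x : F) : exists y, y * y = x.
Proof.
have inj : injective (fun y : F => y * y).
  move=> y z /= /eqP; rewrite -subr_eq0 (oppF char2) => /eqP yz.
  apply/eqP; rewrite -subr_eq0 (oppF char2) -sqrf_eq0 sqrrD !expr2 mulr2n char2 addr0.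
  by rewrite yz.
by exists (invF inj x); rewrite (f_invF inj).
Qed.

(** Transvections along [e1] force [r = 1]. Other elements of [E] then force a diagonal or
    antidiagonal action of [h] on the complement of [e1] modulo [<e1>], and the torus excludes the
    antidiagonal case. *)
Lemma point_char_separates h r : h \in Sp J -> act e1 h = r *: e1 -> h \notin point_set ->
  exists t, [/\ t \in point_set, (t ^ h)%g \in point_set &
    point_char (t ^ h)%g != point_char t].
Proof.
move=> Gh h0 nTh.
pose Goal := exists t, [/\ t \in point_set, (t ^ h)%g \in point_set &
  point_char (t ^ h)%g != point_char t].
have nz_r : r != 0.
  by apply: contraNneq nz_e1 => r0; rewrite (@act_eq0 e1 h) // h0 r0 scale0r.
have e1h v : form e1 v = 0 -> form e1 (act v h) = 0.
  by move=> e1v; apply: (mulfI nz_r); rewrite -formZl -h0 form_act // e1v mulr0.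
have sep v A C : form e1 v = 0 ->
    psi (quad (f1 + (A * r) *: act v h + ((A * form f1 (act v h) + C * r) * r) *: e1))
      != psi (quad (f1 + A *: v + (A * form f1 v + C) *: e1)) -> Goal.
  move=> e1v neq.
  have [|t Gt tE] := @rank2_isometry _ J altJ unitJ char2 e1 v A A C.
    by rewrite e1v !mul0r addr0 char2.
  have thE := rank2_conj Gh tE.
  have Gth : (t ^ h)%g \in Sp J := groupJ Gt Gh.
  have [|||Tt eta_t] := @unipotent_char t (A * form e2 v) (A * form f2 v) Gt;
    rewrite ?tE ?e1v ?sbE ?sum0E //.
  have e1v' := e1h v e1v.
  have [|||Tth eta_th] := @unipotent_char (t ^ h)%g
      (A * form e2 (act v h) * r) (A * form f2 (act v h) * r) Gth.
  - by rewrite thE h0 e1v' !sbE !sum0E.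
  - by rewrite thE h0 !sbE !sum0E scalerA.
  - by rewrite thE h0 !sbE !sum0E scalerA.
  exists t; split=> //; rewrite eta_t eta_th tE thE h0.
  by rewrite !formZr f1e1 !mulr1 scalerA; exact: neq.
have [r1 | r_neq1] := eqVneq (r * r) 1; last first.
  have [y neq] := psi_sep r_neq1; apply: (sep e1 0 y (formxx e1)).
  rewrite h0 /quad !sbE !sum0E.
  by have -> : y * r * r = r * r * y by ring.
move: r1 => /sqr1 r1; rewrite {}r1 scale1r in h0 sep nz_r.
have expand v : form e1 v = 0 -> exists a b k, act v h = a *: e2 + b *: f2 + k *: e1.
  move=> e1v; exists (form (act v h) f2), (form (act v h) e2), (form (act v h) f1).
  rewrite {1}(symp_basis_expand altJ unitJ char2 (act v h) sb) (formC _ e1) e1h //.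
  by rewrite scale0r addr0 -addrA addrC.
have [a [b [k h1]]] := expand e2 e1e2; have [c [d [l h2]]] := expand f2 e1f2.
have [ab0 | nz_ab] := eqVneq (a * b) 0; last first.
  (* The conjugate has [quad] value [y * y * (a * b)], quadratic in the parameter; a square root
     makes it [x0]. *)
  have [y yy] := sqrt_ex (x0 / (a * b)); apply: (sep e2 y 0 e1e2).
  rewrite h1 /quad !sbE !sum0E psi0.
  have -> : y * k + y * k + y * a * (y * b) = (y * k + y * k) + (y * y) * (a * b) by ring.
  by rewrite char2 add0r yy divfK.
have [cd0 | nz_cd] := eqVneq (c * d) 0; last first.
  have [y yy] := sqrt_ex (x0 / (c * d)); apply: (sep f2 y 0 e1f2).
  rewrite h2 /quad !sbE !sum0E psi0.
  have -> : y * l + y * l + y * c * (y * d) = (y * l + y * l) + (y * y) * (c * d) by ring.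
  by rewrite char2 add0r yy divfK.
have D1 : a * d + b * c = 1.
  by have := form_act e2 f2 Gh; rewrite h1 h2 !sbE !sum0E addrC.
have [a0 | nz_a] := eqVneq a 0; last first.
  have b0 : b = 0 by apply: (mulfI nz_a); rewrite ab0 mulr0.
  have da : d = a^-1 by apply: (mulfI nz_a); rewrite mulfV // -[RHS]D1 b0 mul0r addr0.
  have c0 : c = 0.
    by apply: (mulIf (x := d)); rewrite ?mul0r // da invr_eq0.
  case/negP: nTh; apply/pointP; split=> //; exists a, k, l.
  by rewrite h1 h2 b0 c0 da !scale0r !addr0 !add0r.
have bc1 : b * c = 1 by rewrite -[RHS]D1 a0 mul0r add0r.
have nz_c : c != 0 by apply: contraTneq (oner_neq0 F) => c0; rewrite -bc1 c0 mulr0 eqxx.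
have nz_b : b != 0 by apply: contraTneq (oner_neq0 F) => b0; rewrite -bc1 b0 mul0r eqxx.
have d0 : d = 0 by apply: (mulfI nz_c); rewrite cd0 mulr0.
have [t [Gt t0 t1 t2]] := torus.
have Tt : t \in point_set.
  by apply/pointP; split=> //; exists s, 0, 0; rewrite t0 t1 t2 !scale0r !addr0.
have h0' : act e1 h^-1 = e1 by rewrite -{1}h0 actK.
have h1' : act e2 h^-1 = c^-1 *: (f2 + l *: e1).
  apply: (canLR (actK h)); rewrite !(actZ, actD) h0 h2 d0 scale0r addr0.
  by rewrite -addrA -scalerDl char2 scale0r addr0 scalerA mulVf // scale1r.
have h2' : act f2 h^-1 = b^-1 *: (e2 + k *: e1).
  apply: (canLR (actK h)); rewrite !(actZ, actD) h0 h1 a0 scale0r add0r.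
  by rewrite -addrA -scalerDl char2 scale0r addr0 scalerA mulVf // scale1r.
have th0 : act e1 (t ^ h)%g = e1 by rewrite act_conj h0' t0 h0.
have th1 : act e2 (t ^ h)%g = s^-1 *: e2 + (c^-1 * (s^-1 * l + l)) *: e1.
  rewrite act_conj h1' !(actZ, actD) t0 t2 !(actZ, actD) h0 h2 d0.
  by apply/rowP=> i; rewrite !mxE; field; rewrite nz_c nz_s.
have th2 : act f2 (t ^ h)%g = s *: f2 + (b^-1 * (s * k + k)) *: e1.
  rewrite act_conj h2' !(actZ, actD) t0 t1 !(actZ, actD) h0 h1 a0.
  by apply/rowP=> i; rewrite !mxE; field; rewrite nz_b.
have Gth : (t ^ h)%g \in Sp J := groupJ Gt Gh.
have Tth : (t ^ h)%g \in point_set.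
  apply/pointP; split; first exact: Gth.
  by exists s^-1, (c^-1 * (s^-1 * l + l)), (b^-1 * (s * k + k)); rewrite invr_eq0 invrK.
apply: (@mult_on_square _ point_group _ _ _ point_char_mult Tt Tth).
rewrite (point_charE th1) (@point_charE t s 0) ?scale0r ?addr0 //.
rewrite mulrACA psi_sq [X in _ != X]mulrACA psi_sq !mul1r -!alphaM (inj_eq alphaI).
rewrite invrK; apply: contraNneq s4 => E; rewrite (exprD s 2 2) !expr2 {1}E.
by rewrite mulrACA mulVf ?mulr1.
Qed.

Lemma not_strong_gelfand_point (H : {group {'GL_4[F]}}) : H \subset Sp J ->
    point_set \subset H -> (forall h, h \in H -> exists r, act e1 h = r *: e1) ->
  ~ strong_gelfand (Sp J) H.
Proof.
move=> sHG sTH Hact.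
(* A transvection along [e2]; the second flag is [<f1> < <f1, f2 + e2>]. *)
have [|z' Gz' z'E] := @rank2_isometry _ J altJ unitJ char2 e2 e2 0 0 1.
  by rewrite formxx !mul0r !addr0.
have z'1 : act f1 z' = f1 by rewrite z'E !sbE !sum0E.
have z'2 : act f2 z' = f2 + e2 by rewrite z'E !sbE !sum0E.
apply: (@not_strong_gelfand _ (Sp J) H borel point_group _ point_char z'^-1%g
  _ sHG sTH borel_char_mult point_char_mult _ _ _ _ _ _).
- by apply/subsetP=> g; rewrite inE => /andP[].
- by move=> g Gg Bg; exact: borel_char_separates Gg Bg.
- move=> h Hh; have [r h1] := Hact h Hh.
  exact: (point_char_separates (subsetP sHG _ Hh) h1).
- move=> g /setIP[/pointP[Gg [x [k [l [nz_x g0 g1 g2]]]]] /borelP[_ [y [c [z [g3 g4]]]]]].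
  have [E1 _ _] := point_f1 Gg nz_x g0 g1 g2.
  have y1 : y = 1 by move: E1; rewrite g3 !sbE !sum0E.
  have zx : x^-1 = z by have := congr1 (form^~ e2) g4; rewrite g2 /= !sbE !sum0E.
  rewrite (borel_charE g3 g4) (point_charE g1) g3 /quad !sbE !sum0E psi0.
  by rewrite mul1r y1 expr1n mul1r zx.
- by rewrite groupV.
(* [T] creates no [e2]-component in the image of [f2], whereas [b * z'] gives equal components along
   [e2] and [f2]. *)
- apply/negP => /mulsgP[t b Tt /borelP[Gb [x [c [y [_ b2]]]]] Db].
  have Tt' : (t^-1)%g \in point_group by rewrite groupV.
  have Dt' : (t^-1 = b * z')%g by rewrite -[b](mulKg t) -Db mulgKV.
  case/pointP: Tt' => Gt' [r [k [l [nz_r r0 r1 r2]]]].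
  move: r2; rewrite Dt' actM b2 !(actD, actZ) z'1 z'2 => E.
  have := congr1 (form^~ f2) E; have := congr1 (form^~ e2) E.
  rewrite /= !sbE !sum0E => -> /eqP.
  by rewrite invr_eq0 (negPf nz_r).
move=> t Tt; rewrite conjgE invgK => /borelP[_ [x [c [y [b1 b2]]]]].
case/pointP: (Tt) => Gt [r [k [l [nz_r r0 r1 r2]]]].
have [E _ _] := point_f1 Gt nz_r r0 r1 r2.
have b1' : act f1 t = x *: f1 by rewrite -{1}z'1 -{2}z'1 -actZ -b1 !actM actKV.
have b2' : act f2 t + act e2 t = c *: f1 + y *: (f2 + e2).
  by rewrite -actD -z'2 -{1}z'1 -!actZ -actD -b2 !actM actKV.
have x1 : x = 1 by move: E; rewrite b1' !sbE !sum0E.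
have ry : r = y.
  by move: (congr1 (form^~ f2) b2'); rewrite /= r1 r2 !sbE !sum0E.
have ry' : r^-1 = y.
  by move: (congr1 (form^~ e2) b2'); rewrite /= r1 r2 !sbE !sum0E.
(* The eigenvalues [r] and [r^-1] on [e2] and [f2] agree modulo [<e1>], so they are [1] and both
   characters are trivial here. *)
have y1 : y = 1 by apply: sqr1; rewrite -{1}ry' -ry mulVf.
rewrite (borel_charE b1 b2) (point_charE r1) b1' ry y1 x1 /quad.
by rewrite invr1 expr1n !sbE !sum0E psi0 mul1r.
Qed.

End Point.
End Parabolics.

(** * Both parabolics over a field of even order at least 8 *)

Theorem theorem4p1 (F : finFieldType) (e : nat) (J : 'M[F]_4)
    (u : 'rV[F]_4) (W : 'M[F]_(2, 4)) :
  (2 < e)%N -> #|F| = (2 ^ e)%N ->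
  alt_form J -> nondeg_form J ->
  \rank u = 1%N ->
  \rank W = 2%N -> (W *m J *m W^T = 0)%R ->
  ~ strong_gelfand (Sp J) (parabolic J u) /\
  ~ strong_gelfand (Sp J) (parabolic J W).
Proof.
move=> e_gt2 cardF altJ unitJ rank_u rank_W W0.
have char2 (x : F) : x + x = 0.
  by rewrite -mulr2n -mulr_natr (pcharf0 (card_finPcharP cardF isT)) mulr0.
have [alpha [alpha1 alphaM alphaI]] := finField_inj_char F.
have [psi [psi0 psiD [x0 psi_x0]]] := finField_add_char F.
have [s prim_s] := finField_prim_root F.
(* As [q >= 8], the order [q - 1] of [s] exceeds [4], which gives all the separation conditions on
   [s]. *)
have n_gt4 : (4 < #|F|.-1)%N.
  by rewrite cardF -ltnS prednK ?expn_gt0 //; apply: (@leq_trans (2 ^ 3)); rewrite ?leq_exp2l.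
have s_neq1 k : (0 < k < 5)%N -> s ^+ k != 1.
  case/andP=> k_gt0 k_lt5; rewrite -(prim_order_dvd prim_s).
  by rewrite gtnNdvd // (leq_trans _ n_gt4).
have nz_s : s != 0.
  apply: contraTneq (oner_neq0 F) => s0; rewrite negbK -(prim_expr_order prim_s) s0.
  by rewrite expr0n gtn_eqF ?(ltn_trans _ n_gt4) // eqxx.
split.
  have nz_u : u != 0 by rewrite -mxrank_eq0 rank_u.
  have [e2 [f1 [f2 sb]]] := symp_basis_vector altJ unitJ char2 nz_u.
  apply: (not_strong_gelfand_point altJ unitJ char2 alpha1 alphaM alphaI psi0 psiD psi_x0
            nz_s (s_neq1 2%N isT) (s_neq1 3%N isT) (s_neq1 4%N isT) sb).
  - exact: subsetIl.
  - apply/subsetP => g /(pointP altJ char2 sb)[Gg [_ [_ [_ [_ g0 _ _]]]]].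
    by rewrite inE Gg inE -/(act u g) g0 submx_refl.
  move=> h /setIP[_]; rewrite inE => /andP[/sub_rVP[r h0] _].
  by exists r.
have [f1 [f2 sb]] := symp_basis_plane altJ unitJ char2 rank_W W0.
apply: (not_strong_gelfand_plane altJ unitJ char2 alpha1 alphaM alphaI psi0 psiD psi_x0
          nz_s (s_neq1 2%N isT) (s_neq1 3%N isT) (s_neq1 4%N isT) sb).
- exact: subsetIl.
- apply/subsetP => g /(planeP sb)[Gg [x [nz_x g1 g2]]].
  (* As [g] is invertible the ranks agree, so one inclusion of row spaces suffices. *)
  rewrite inE Gg inE -(mxrank_leqif_eq _).2.
    rewrite mxrankMfree ?eqxx // row_free_unit.
    exact: (valP g).
  apply/row_subP => i; rewrite row_mul.
  case: i => -[|[|//]] lt_i.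
    rewrite (_ : Ordinal lt_i = 0); last exact: val_inj.
    by rewrite -/(act _ g) g1 scalemx_sub ?row_sub.
  rewrite (_ : Ordinal lt_i = 1); last exact: val_inj.
  by rewrite -/(act _ g) g2 scalemx_sub ?row_sub.
move=> h /setIP[_]; rewrite inE => /andP[Wh _].
have combo i : exists a b, act (row i W) h = a *: row 0 W + b *: row 1 W.
  have /submxP[D rowE] := row_subP Wh i.
  exists (D 0 0), (D 0 1); rewrite /act -row_mul rowE mulmx_sum_row.
  rewrite !big_ord_recl big_ord0 addr0 (_ : lift ord0 ord0 = 1) //; exact: val_inj.
have [a [b h1]] := combo 0; have [c [d h2]] := combo 1.
by exists a, b, c, d.
Qed.
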